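(* Let $T$ be a continuous linear operator on a Polish topological vector space $X$ with $\mathcal P_{T,*}(X)\neq\emptyset$, and let $F$ be a closed subset of $X$ such that (i) $F-F$ is dilation-invariant and nowhere dense in $X$; (ii) $T(F\setminus\ker^*(T))\subset F$; (iii) $T(\overline{F-F}\setminus\ker^*(T))\subset\overline{F-F}$. Then $\mathcal P_{T,*}(X\setminus F)$ is a dense $G_\delta$ subset of $\mathcal P_T(X)$.
   Context: $\mathcal P_T(X)$: $T$-invariant Borel probability measures with the Prokhorov topology; $\mathcal P_{T,*}(X)$: those with full support; $\mathcal P_{T,*}(A)=\{m\in\mathcal P_{T,*}(X): m(A)=1\}$. $\ker^*(T)=\bigcup_{k\in\mathbb N}\ker(T^k)$. $F-F=\{x-y:x,y\in F\}$. A set $A$ is dilation-invariant if $r\cdot A=A$ for every $r>0$. *)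

(* Defs.v *)
From HB Require Import structures.
From mathcomp Require Import all_boot all_order all_algebra.
From mathcomp Require Import all_classical all_reals all_analysis.
Set Implicit Arguments. Unset Strict Implicit. Unset Printing Implicit Defensive.
Import Order.TTheory GRing.Theory Num.Theory.
Import numFieldNormedType.Exports.
Local Open Scope classical_set_scope.
Local Open Scope ring_scope.

(* pointed copy of a topological vector space (pointed at 0), needed to form
   the generated sigma-algebra *)
Definition ptX (R : realType) (X : topologicalLmodType R) : Type := X.
HB.instance Definition _ (R : realType) (X : topologicalLmodType R) :=
  Choice.on (ptX X).
HB.instance Definition _ (R : realType) (X : topologicalLmodType R) :=
  isPointed.Build (ptX X) (0%R : X).

Section Defs.
Context (R : realType) (X : topologicalLmodType R).

Definition polish_space : Prop :=
  (exists D : set X, countable D /\ closure D = setT) /\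
  exists d : X -> X -> R,
    (forall x y, 0 <= d x y) /\
    [/\ (forall x y, d x y = 0 <-> x = y),
        (forall x y, d x y = d y x),
        (forall x y z, d x z <= d x y + d y z),
        (forall (x : X) (A : set X),
            nbhs x A <-> exists2 e : R, 0 < e & [set y | d x y < e] `<=` A) &
        (forall u : nat -> X,
            (forall e : R, 0 < e -> exists N, forall m n, (N <= m)%N -> (N <= n)%N ->
                d (u m) (u n) < e) ->
            exists l, forall e : R, 0 < e -> exists N, forall n, (N <= n)%N -> d (u n) l < e)].

Definition Borel : measurableType (sigma_display (@open X : set (set (ptX X)))) :=
  g_sigma_algebraType (@open X : set (set (ptX X))).

Definition measures := probability Borel R.

Definition T_invariant (T : X -> X) (m : measures) : Prop :=
  forall A : set Borel, measurable A -> m (T @^-1` A) = m A.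

Definition full_support (m : measures) : Prop :=
  forall U : set X, open U -> U !=set0 -> (0 < m U)%E.

Definition PT (T : X -> X) : set measures := [set m | T_invariant T m].

Definition PTstar (T : X -> X) (A : set X) : set measures :=
  [set m | T_invariant T m /\ full_support m /\ m A = 1%E].

Definition bounded_continuous (f : X -> R) : Prop :=
  continuous f /\ exists M : R, forall x, `|f x| <= M.

Definition weak_open (U : set measures) : Prop :=
  forall m, U m -> exists (fs : seq (X -> R)) (eps : R),
    [/\ 0 < eps, (forall f, f \in fs -> bounded_continuous f) &
      [set m' : measures | forall f, f \in fs ->
         (`| \int[m']_x (f x)%:E - \int[m]_x (f x)%:E | < eps%:E)%E] `<=` U].

Definition dense_in (P S : set measures) : Prop :=
  S `<=` P /\ forall U, weak_open U -> U `&` P !=set0 -> U `&` S !=set0.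

Definition Gdelta_in (P S : set measures) : Prop :=
  exists U : nat -> set measures,
    (forall n, weak_open (U n)) /\ S = P `&` \bigcap_n U n.

Definition kerstar (T : X -> X) : set X := [set x | exists k : nat, iter k T x = 0].

Definition diffset (F : set X) : set X := [set x - y | x in F & y in F].

Definition dilation_invariant (A : set X) : Prop :=
  forall r : R, 0 < r -> [set r *: x | x in A] = A.

Definition nowhere_dense (A : set X) : Prop := interior (closure A) = set0.

End Defs.

(* Main.v *)
(* Density.  Let [C] be the closure of [F - F].  Conditioning a full-support
   invariant measure on the complement of [C] and of the eventual kernel keeps it
   invariant and of full support, since an invariant measure does not charge
   [kerstar T] outside [0] and [C] is nowhere dense; so there is a full-support
   invariant [n] with [n C = 0].  For [x ~ m] and [y ~ n] independent, the law of
   [x + r y] is invariant, has full support, and tends to [m] as [r -> 0].  By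
   dilation invariance the events [x + r y \in F], [r > 0], are pairwise disjoint
   up to null sets, so [x + r y] avoids [F] almost surely for all but countably
   many [r].
   The G_delta property holds because [m A < c] is a weakly open condition on [m]
   for closed [A], applied to [F] and to the complements of a countable basis. *)
Require Import Defs.
From HB Require Import structures.
From mathcomp Require Import all_boot all_order all_algebra.
From mathcomp Require Import all_classical all_reals all_analysis measurable_realfun.
Import Order.TTheory GRing.Theory Num.Theory.
Import numFieldNormedType.Exports.
Local Open Scope classical_set_scope.
Local Open Scope ring_scope.

(** * Disjoint families of events in a probability space *)

Lemma countable_measure_gt0 (d : measure_display) (T : measurableType d)
    (R : realType) (P : probability T R) (A : R -> set T) :
  (forall r, measurable (A r)) -> trivIset setT A ->
  countable [set r | (0 < P (A r))%E].
Proof.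
move=> mA tA.
have finA r : P (A r) \is a fin_num by exact: fin_num_measure.
have -> : [set r | (0 < P (A r))%E] =
    \bigcup_n [set r | ((n.+1%:R^-1)%:E < P (A r))%E].
  apply/seteqP; split=> [r /= + | r /= [n _]].
    rewrite -{1}(fineK (finA r)) lte_fin => /ltr_add_invr[n]; rewrite add0r => nr.
    by exists n => //=; rewrite -(fineK (finA r)) lte_fin.
  by apply: le_lt_trans; rewrite lee_fin.
apply: bigcup_countable => // n _; apply: finite_set_countable.
apply: contrapT => /infiniteP/pcard_leP/injfunPex[/= q qn q_inj].
have tAq : trivIset setT (A \o q).
  apply/trivIsetP => i j _ _ ij; move/trivIsetP: tA; apply => //.
  by apply: contra_neq ij; apply: q_inj; rewrite inE.
(* Infinitely many indices above the threshold [1/(n+1)] would supply [n+2] disjoint sets of total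
   mass at least [(n+2)/(n+1) > 1]. Taking [n+2] sets, not [n+1], makes termwise weak inequalities
   enough. *)
have : (\sum_(i < n.+2) P (A (q i)) <= 1)%E.
  rewrite -(measure_bigsetU P (fun i => mA (q i)) tAq) probability_le1//.
  by apply: bigsetU_measurable.
apply/negP; rewrite -ltNge.
apply: (@lt_le_trans _ _ (\sum_(i < n.+2) (n.+1%:R^-1 : R)%:E)%E).
  rewrite sumEFin lte_fin sumr_const card_ord -[ltRHS]mulr_natl.
  by rewrite ltr_pdivlMr// mul1r ltr_nat.
by apply: lee_sum => i _; apply/ltW/qn.
Qed.

(** Otherwise the whole interval []0, e[] would consist of indices of positive measure, of which
    there are only countably many; but its Lebesgue measure is [e > 0]. *)
Lemma exists_small_measure0 (d : measure_display) (T : measurableType d)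
    (R : realType) (P : probability T R) (A : R -> set T) (e : R) :
  (forall r, measurable (A r)) ->
  (forall r s, 0 < r -> 0 < s -> r != s -> A r `&` A s = set0) ->
  0 < e -> exists r, [/\ 0 < r, r < e & P (A r) = 0%E].
Proof.
move=> mA tA e0.
(* Disjointness is known for positive indices only, so the other members of the family are replaced
   by the empty set. *)
pose B r := if 0 < r then A r else set0.
have mB r : measurable (B r) by rewrite /B; case: ifP.
have tB : trivIset setT B.
  apply/trivIsetP => r s _ _ rs; rewrite /B.
  case: ifPn => r0; last by rewrite set0I.
  by case: ifPn => s0; [exact: tA|rewrite setI0].
have cB := countable_measure_gt0 _ _ _ P _ mB tB.
apply: contrapT => nex.
have sub : `]0, e[%classic `<=` [set r | (0 < P (B r))%E].
  move=> r /=; rewrite in_itv/= => /andP[r0 re].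
  rewrite lt0e measure_ge0 andbT; apply/negP => /eqP PB; apply: nex.
  by exists r; split => //; rewrite /B r0 in PB.
have : lebesgue_measure (`]0, e[%classic : set R) = 0%E.
  apply: countable_lebesgue_measure0.
  exact: sub_countable (subset_card_le sub) cB.
by rewrite lebesgue_measure_itv/= lte_fin e0 sube0 => -[] /eqP; rewrite gt_eqF.
Qed.

(** * Countable bases and approximation of indicators in Polish spaces *)

Section Polish.
Context (R : realType) (X : topologicalLmodType R).
Hypothesis pX : polish_space X.

Lemma polish_countable_basis : exists B : nat -> set X,
  [/\ forall n, open (B n), forall n, B n !=set0 &
      forall x (U : set X), nbhs x U -> exists2 n, B n x & B n `<=` U].
Proof.
case: pX => -[D [cD dD]] [d [d0 [dE dC dT dN _]]].
have [D0|[/= f]] := pfcard_geP cD.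
  by move: dD; rewrite D0 closure0 => /seteqP[_ /(_ 0 I)].
have ball_open (x : X) (e : R) : open [set y | d x y < e].
  rewrite openE => y /= xy; apply/dN; exists (e - d x y); first by rewrite subr_gt0.
  by move=> z /= yz; apply: (le_lt_trans (dT x y z)); rewrite -ltrBrDl.
(* The basis consists of the balls of radius [1/(k+1)] about the points of a countable dense set.
   [n] encodes the pair (centre, [k]), with [(0, 0)] as default for a non-code. *)
exists (fun n => [set y | d (f (odflt (0, 0)%N (unpickle n)).1) y <
   ((odflt (0, 0)%N (unpickle n)).2.+1%:R)^-1]); split => [n|n|x U].
- exact: ball_open.
- exists (f (odflt (0, 0)%N (unpickle n)).1) => /=.
  by rewrite (proj2 (dE _ _) erefl) invr_gt0.
- move=> /dN[e e0 eU].
  (* A radius below [e/2] is chosen so that a ball containing [x] stays inside the [e]-ball about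
     [x]. *)
  have [k ke] := ltr_add_invr (divr_gt0 e0 (@ltr0n R 2)).
  rewrite add0r in ke.
  have : closure D x by rewrite dD.
  have xk : nbhs x [set y | d x y < k.+1%:R^-1].
    by apply/dN; exists k.+1%:R^-1; rewrite ?invr_gt0.
  move=> /(_ _ xk)[y [Dy xy]].
  have [n _ fny] : (f @` setT) y.
    by have := @surj _ _ setT D f; apply.
  exists (pickle (n, k)); rewrite pickleK/= fny; first by rewrite /= dC.
  move=> z /= yz; apply: eU => /=.
  by apply: (le_lt_trans (dT x y z)); rewrite [e]splitr ltrD// (lt_trans _ ke).
Qed.

(** The functions are [1 - min(1, n d(x, A))]. They equal 1 on [A], and off [A] they vanish once
    [n d(x, A) >= 1], the distance being positive because [A] is closed. *)
Lemma closed_indic_approx (A : set X) : closed A -> exists f : nat -> X -> R,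
  [/\ forall n, continuous (f n), forall n x, 0 <= f n x <= 1,
      forall n x, A x -> f n x = 1 & forall x, f ^~ x @ \oo --> (\1_A x : R)].
Proof.
case: pX => -[D [cD dD]] [d [d0 [dE dC dT dN _]]] cA.
(* The infimum of [S n x] is the truncated distance [min(1, n d(x, A))]; the element 1 provides the
   truncation and keeps the set nonempty when [A] is empty. *)
pose S n x := [set 1] `|` [set n%:R * d x y | y in A].
have S0 n x : S n x !=set0 by exists 1; left.
have Sge0 n x : lbound (S n x) 0.
  by move=> _ [->//|[y _ <-]]; rewrite mulr_ge0.
have infS n x : has_inf (S n x) by split; [exact: S0|exists 0].
pose g n x := inf (S n x).
have g0 n x : 0 <= g n x by apply: lb_le_inf.
have g1 n x : g n x <= 1 by apply: ge_inf; [exists 0|left].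
have gA n x : A x -> g n x = 0.
  move=> Ax; apply/eqP; rewrite eq_le g0 andbT.
  apply: ge_inf; first by exists 0.
  by right; exists x => //; rewrite (proj2 (dE _ _) erefl) mulr0.
have gL n x y : g n x <= g n y + n%:R * d x y.
  rewrite -lerBlDr; apply: lb_le_inf => // _ [->|[z Az <-]].
    by rewrite lerBlDr (le_trans (g1 n x))// lerDl mulr_ge0.
  rewrite lerBlDr; apply: (@le_trans _ _ (n%:R * d x z)).
    by apply: ge_inf; [exists 0|right; exists z].
  by rewrite -mulrDr ler_wpM2l// addrC dT.
exists (fun n x => 1 - g n x); split.
- move=> n; suff cg : continuous (g n).
    by move=> x; apply: cvgB; [exact: cvg_cst|exact: cg].
  move=> x; apply/cvgrPdist_lt => e e0; near=> y.
  (* The Lipschitz constant of [g n] is [n]; dividing by [n+1] also covers [n = 0]. *)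
  have : d x y < e / (n.+1%:R).
    near: y; apply/dN; exists (e / n.+1%:R) => //.
    by rewrite divr_gt0.
  rewrite ltr_pdivlMr// => xy.
  apply: (@le_lt_trans _ _ (n%:R * d x y)).
    rewrite ler_norml; apply/andP; split; last by rewrite lerBlDl gL.
    by rewrite lerBrDl -lerBrDr opprK dC gL.
  apply: le_lt_trans xy.
  by rewrite mulrC ler_wpM2l// ler_nat.
- by move=> n x; rewrite subr_ge0 g1 gerBl g0.
- by move=> n x Ax; rewrite gA// subr0.
- move=> x; rewrite indicE; case: (boolP (x \in A)) => [/set_mem Ax|/negP nAx].
    by under eq_fun do rewrite gA// subr0; exact: cvg_cst.
  have : nbhs x (~` A).
    by apply: open_nbhs_nbhs; split; [exact: closed_openC|move=> Ax; apply/nAx/mem_set].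
  move=> /dN[e e0 eA].
  have ge1 n y : e^-1 <= n%:R -> A y -> 1 <= n%:R * d x y.
    move=> en Ay; have : e <= d x y by rewrite leNgt; apply/negP => /eA.
    move=> exy; rewrite -[leLHS](mulVf (lt0r_neq0 e0)).
    by apply: ler_pM => //; rewrite ?invr_ge0 ltW.
  have [N _ HN] := nbhs_infty_ger (e^-1).
  apply/cvgrPdist_lt => r r0; exists N => // n /HN /= en.
  have -> : g n x = 1.
    apply/eqP; rewrite eq_le g1/=; apply: lb_le_inf => // _ [->//|[y Ay <-]].
    exact: ge1.
  by rewrite subrr subr0 normr0.
Unshelve. all: end_near. Qed.

End Polish.

(** * Integrals of bounded functions *)

Lemma bounded_measurable_integrable (d : measure_display) (Y : measurableType d)
    (R : realType) (P : probability Y R) (f : Y -> R) (M : R) :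
  measurable_fun setT f -> (forall y, `|f y| <= M) ->
  P.-integrable setT (EFin \o f).
Proof.
move=> mf fM.
apply: (@le_integrable _ _ _ _ _ measurableT _ (EFin \o cst M)) => //=.
- exact/measurable_EFinP.
- by move=> y _; rewrite lee_fin (le_trans (fM _))// ler_norm.
- exact: finite_measure_integrable_cst.
Qed.

Lemma bounded_cvg_integral (d : measure_display) (Y : measurableType d)
    (R : realType) (P : probability Y R) (f : nat -> Y -> R) (g : Y -> R) (M : R) :
  (forall n, measurable_fun setT (f n)) -> (forall n y, `|f n y| <= M) ->
  (forall y, f ^~ y @ \oo --> g y) ->
  (\int[P]_y (f n y)%:E @[n --> \oo] --> \int[P]_y (g y)%:E)%E.
Proof.
move=> mf fM fg.
apply: (@dominated_cvg _ _ _ P setT measurableT (fun n y => (f n y)%:E)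
  (fun y => (g y)%:E) (cst M%:E)) => //.
- by move=> n; exact/measurable_EFinP.
- by move=> y _; apply: cvg_EFin; [exact: nearW|exact: fg].
- by apply: finite_measure_integrable_cst.
- by move=> n y _; rewrite lee_fin.
Qed.

(** * Borel measurability and weakly open conditions on measures *)

Section Borel.
Context (R : realType) (X : topologicalLmodType R).

Lemma Borel_open (U : set X) : open U -> measurable (U : set (Borel X)).
Proof. by move=> oU; apply: sub_sigma_algebra. Qed.

Lemma Borel_closed (A : set X) : closed A -> measurable (A : set (Borel X)).
Proof.
move=> cA; rewrite -(setCK A); apply: measurableC.
exact: Borel_open (closed_openC cA).
Qed.

Lemma continuous_Borel_real (f : X -> R) :
  continuous f -> measurable_fun setT (f : Borel X -> R).
Proof.
move=> /continuousP cf; apply: (measurability _ (RGenOpens.measurableE R)).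
move=> _ [_ [a [b ->] <-]]; rewrite setTI; apply: Borel_open.
exact/cf/interval_open.
Qed.

Lemma measurable_fun_Borel (d : measure_display) (Y : measurableType d)
    (f : Y -> X) : (forall U, open U -> measurable (f @^-1` U)) ->
  measurable_fun setT (f : Y -> Borel X).
Proof.
move=> mf; apply: (@measurability _ _ _ (Borel X) _ _ (@open X)) => //.
by move=> _ [U oU <-]; rewrite setTI; exact: mf.
Qed.

Lemma continuous_Borel (f : X -> X) :
  continuous f -> measurable_fun setT (f : Borel X -> Borel X).
Proof.
move=> /continuousP cf; apply: measurable_fun_Borel => U oU.
exact: Borel_open (cf _ oU).
Qed.

Hypothesis pX : polish_space X.

(** The source carries the product sigma-algebra, in which open sets of [X * X] must be shown
    measurable: by the countable basis, each is a countable union of open rectangles. *)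
Lemma continuous_Borel2 (f : X * X -> X) : continuous f ->
  measurable_fun setT (f : Borel X * Borel X -> Borel X).
Proof.
move=> cf; apply: measurable_fun_Borel => U oU.
have [B [oB _ Bb]] := polish_countable_basis R X pX.
have -> : f @^-1` U = \bigcup_i \bigcup_j
    (if `[< B i `*` B j `<=` f @^-1` U >] then B i `*` B j else set0).
  apply/seteqP; split=> [z fzU|z [i _ [j _]]]; last by case: asboolP => // + Bz; apply.
  have : nbhs z (f @^-1` U) by apply: cf; exact: open_nbhs_nbhs.
  move=> [[P Q]/= [/Bb[i Bi iP] /Bb[j Bj jQ]] PQ].
  exists i => //; exists j => //; case: asboolP => // -[] [a b] [/= /iP Pa /jQ Qb].
  exact: PQ.
apply: bigcupT_measurable => i; apply: bigcupT_measurable => j; case: asboolP => // _.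
by apply: measurableX; exact: Borel_open.
Qed.

(** One half of the portmanteau theorem. The integrals of the approximants [f n] decrease the
    problem to a single test function: some [f N] has integral [a < c] against [m], and since [f N]
    dominates the indicator of [A], any [p] whose integral of [f N] is within [c - a] of [a]
    satisfies [p A < c]. *)
Lemma weak_open_closed_lt (A : set X) (c : R) :
  closed A -> weak_open [set m : measures X | m A < c%:E]%E.
Proof.
move=> cA m /= mAc.
have [f [cf f01 fA fcvg]] := closed_indic_approx R X pX A cA.
have mA := Borel_closed A cA.
have mf n : measurable_fun setT (f n : Borel X -> R) by exact: continuous_Borel_real.
have fN n x : `|f n x| <= 1.
  by rewrite ger0_norm; have /andP[] := f01 n x.
have intf n (p : measures X) : p.-integrable setT (EFin \o f n).
  by apply: (bounded_measurable_integrable _ _ _ _ _ 1) => //; exact: mf.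
have cv : (\int[m]_x (f n x)%:E @[n --> \oo] --> m A)%E.
  rewrite -[X in _ --> X](_ : \int[m]_x (\1_A x : R)%:E = _)%E.
    exact: (@bounded_cvg_integral _ _ _ m f _ 1).
  by rewrite integral_indic// setIT.
have : \forall n \near \oo, (\int[m]_x (f n x)%:E < c%:E)%E.
  exact: cv (open_ereal_lt' mAc).
move=> [N _ /(_ N (leqnn N))/=].
have fin p := integrable_fin_num measurableT (intf N p).
set a := (X in (X < _)%E) => ac.
have afin : a \is a fin_num by exact: fin.
exists [:: f N], (c - fine a); split.
- by rewrite subr_gt0 -lte_fin fineK.
- move=> _ /[!inE] ->; split; first exact: cf.
  by exists 1.
- move=> p /= /(_ (f N)); rewrite inE eqxx => /(_ isT).
  rewrite -/a => h.
  have : (p A <= \int[p]_x (f N x)%:E)%E.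
    have <- : (\int[p]_x (\1_A x : R)%:E = p A)%E by rewrite integral_indic// setIT.
    apply: ge0_le_integral => //.
    - by apply/measurable_EFinP; exact: measurable_indic.
    - exact/measurable_EFinP.
    - move=> x _; rewrite lee_fin indicE.
      case: (boolP (x \in A)) => [/set_mem/fA->//|_].
      by have /andP[] := f01 N x.
  move=> /le_lt_trans; apply; move: h.
  rewrite -(fineK afin) -(fineK (fin p)) lte_fin lte_fin => /ltr_normlP[_].
  by rewrite /= ltrD2r.
Qed.

Lemma weak_openI (U V : set (measures X)) :
  weak_open U -> weak_open V -> weak_open (U `&` V).
Proof.
move=> oU oV m [/oU[fs [e [e0 fsb fsU]]] /oV[gs [r [r0 gsb gsV]]]].
exists (fs ++ gs), (Num.min e r); split; first by rewrite lt_min e0.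
- by move=> f; rewrite mem_cat => /orP[/fsb|/gsb].
- move=> p /= h; split.
    apply: fsU => f ffs /=; have := h f; rewrite mem_cat ffs => /(_ isT).
    by move=> /lt_le_trans; apply; rewrite lee_fin ge_min lexx.
  apply: gsV => f ffs /=; have := h f; rewrite mem_cat ffs orbT => /(_ isT).
  by move=> /lt_le_trans; apply; rewrite lee_fin ge_min lexx orbT.
Qed.

Lemma full_support_Gdelta (P : set (measures X)) (F : set X) : closed F ->
  Gdelta_in P [set m | P m /\ full_support m /\ m (~` F) = 1%E].
Proof.
move=> cF; have [B [oB B0 Bb]] := polish_countable_basis R X pX.
exists (fun n => [set m : measures X | m (~` B n) < 1%:E]%E `&`
                 [set m : measures X | m F < (n.+1%:R^-1)%:E]%E); split => [n|].
  by apply: weak_openI; apply: weak_open_closed_lt => //; exact: open_closedC.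
have mB n : measurable (B n : set (Borel X)) by exact: Borel_open.
have mF := Borel_closed F cF.
have mCB (m : measures X) n : (m (~` B n) < 1 <-> 0 < m (B n))%E.
  rewrite probability_setC//.
  have mBn : m (B n) \is a fin_num by exact: fin_num_measure.
  by rewrite -[m _]fineK//= lte_fin lte_fin ltrBlDl ltrDr.
have mCF (m : measures X) : m (~` F) = 1%E <-> m F = 0%E.
  rewrite probability_setC//.
  have mFf : m F \is a fin_num by exact: fin_num_measure.
  rewrite -(fineK mFf) -EFinB; split=> [[] /eqP|[] ->]; last by rewrite subr0.
  by rewrite -subr_eq0 addrAC subrr sub0r oppr_eq0 => /eqP ->.
apply/seteqP; split=> [m [Pm [fm /mCF mF0]]|m [Pm h]].
  split => // n _; split => /=; first by apply/mCB/fm.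
  by rewrite mF0 lte_fin.
split => //; split => [U oU [x Ux]|].
  have [n Bnx BnU] := Bb x U (open_nbhs_nbhs (conj oU Ux)).
  apply: (@lt_le_trans _ _ (m (B n))); first by apply/mCB; have [] := h n I.
  by rewrite le_measure// inE//; exact: Borel_open.
apply/mCF/eqP; rewrite eq_le measure_ge0 andbT leNgt; apply/negP => mF0.
have mFf : m F \is a fin_num by exact: fin_num_measure.
move: mF0; rewrite -(fineK mFf) lte_fin => /ltr_add_invr[k]; rewrite add0r.
have [_ /=] := h k I; rewrite -{1}(fineK mFf) lte_fin => h1 h2.
by have := lt_trans h1 h2; rewrite ltxx.
Qed.

End Borel.

(** Supplies the law of [f] as a bundled probability, the form that membership in [measures X]
    requires. *)
Lemma exists_pushforward_probability (d d' : measure_display)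
    (Y : measurableType d) (Z : measurableType d') (R : realType)
    (P : probability Y R) (f : Y -> Z) : measurable_fun setT f ->
  exists p : probability Z R, p = pushforward P f :> (set Z -> \bar R).
Proof.
move=> mf.
pose mfb := isMeasurableFun.Build _ _ _ _ f mf.
pose g : {mfun Y >-> Z} := MeasurableFun.Pack (MeasurableFun.Class mfb).
by exists (distribution P g).
Qed.

(** * The eventual kernel and conditioning off a closed set *)

Section Conditioning.
Context (R : realType) (X : topologicalLmodType R).
Hypothesis pX : polish_space X.

Lemma polish_closed1 (x : X) : closed [set x].
Proof.
case: pX => _ [d [d0 [dE dC dT dN _]]].
rewrite -(setCK [set x]); apply: open_closedC; rewrite openE => y /= yx.
apply/dN; exists (d y x).
  by rewrite lt_def d0 andbT; apply/eqP => /dE.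
by move=> z /= yz zx; move: yz; rewrite zx ltxx.
Qed.

Variable T : {linear X -> X}.
Hypothesis cT : continuous T.

Lemma iter_continuous k : continuous (iter k T).
Proof.
by elim: k => [|k IH] x; [exact: cvg_id|exact: continuous_comp (IH x) (cT _)].
Qed.

Lemma iter_invariant (m : measures X) k (A : set X) : T_invariant T m ->
  measurable (A : set (Borel X)) -> m (iter k T @^-1` A) = m A.
Proof.
move=> mT mA; elim: k => [//|k IH].
rewrite -[RHS]IH -[RHS]mT.
  by congr (m _); apply/seteqP; split=> x /=; rewrite -iterS iterSr.
rewrite -[X in measurable X]setTI; apply: continuous_Borel => //.
exact: iter_continuous.
Qed.

Lemma kerstar_bigcup : kerstar T = \bigcup_k (iter k T @^-1` [set 0]).
Proof. by apply/seteqP; split=> x [k]; [exists k|move=> _; exists k]. Qed.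

Lemma measurable_ker_iter k : measurable (iter k T @^-1` [set 0] : set (Borel X)).
Proof.
apply: Borel_closed; apply: closed_comp; last exact: polish_closed1.
by move=> x _; exact: iter_continuous.
Qed.

Lemma measurable_kerstar : measurable (kerstar T : set (Borel X)).
Proof.
by rewrite kerstar_bigcup; apply: bigcupT_measurable => k; exact: measurable_ker_iter.
Qed.

(** The kernel of [T^k] is the preimage of [{0}] under [T^k], so by invariance it has the same
    finite mass as its subset [{0}]; the difference is null, and there are countably many [k]. *)
Lemma kerstar_D0_null (m : measures X) : T_invariant T m ->
  m (kerstar T `\` [set 0]) = 0%E.
Proof.
move=> mT; have m0 : measurable ([set 0] : set (Borel X)).
  exact: Borel_closed (polish_closed1 0).
apply/negligibleP; first exact: measurableD measurable_kerstar m0.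
rewrite kerstar_bigcup setD_bigcupl; apply: negligible_bigcup => k.
have mk := measurable_ker_iter k.
apply/negligibleP; first exact: measurableD.
rewrite measureD// -?ge0_fin_numE ?fin_num_measure//.
rewrite (_ : _ `&` _ = [set 0]); last first.
  apply/seteqP; split=> [x []//|x /= ->]; split => //=.
  by elim: (k) => //= j ->; rewrite linear0.
transitivity (m (iter k T @^-1` [set 0%R]) - m [set 0%R])%E => //.
by rewrite iter_invariant// subee// fin_num_measure.
Qed.

Lemma exists_conditioned_measure (C : set X) (m : measures X) :
  closed C -> C 0 -> C^° = set0 -> T @` (C `\` kerstar T) `<=` C ->
  PTstar T setT m -> exists2 p, PTstar T setT p & p C = 0%E.
Proof.
move=> cC C0 nC TC [mT [fm _]].
pose E : set (Borel X) := ~` (C `|` kerstar T).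
have mC := Borel_closed R X C cC.
have mE : measurable E.
  by apply: measurableC; apply: measurableU => //; exact: measurable_kerstar.
have mTi (A : set (Borel X)) : measurable A -> measurable (T @^-1` A : set (Borel X)).
  by move=> mA; rewrite -[X in measurable X]setTI; exact: continuous_Borel.
(* Contrapositively, [T] maps the complement of [E] into itself: points of [C] off the kernel stay
   in [C], and the eventual kernel is [T]-stable. *)
have TE : T @^-1` E `<=` E.
  move=> x ETx [Cx|[k kx]]; apply: ETx.
    case: (pselect (kerstar T x)) => [[k kx]|nx]; [right|left].
      by exists k; rewrite -iterSr /= kx linear0.
    by apply: TC; exists x.
  by right; exists k; rewrite -iterSr /= kx linear0.
(* [U] minus [C] is nonempty and open because [C] is closed with empty interior. Removing the
   eventual kernel from it costs no mass, since [0] already lies in [C]. *)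
have posE (U : set X) : open U -> U !=set0 -> (0 < m (U `&` E))%E.
  move=> oU [x Ux].
  have V0 : (U `\` C) !=set0.
    apply: contrapT => h; have : C^° x.
      apply: filterS (open_nbhs_nbhs (conj oU Ux)) => y Uy.
      by apply: contrapT => nCy; apply: h; exists y.
    by rewrite nC.
  have oV : open (U `\` C) by apply: openI => //; exact: closed_openC.
  apply: (lt_le_trans (fm _ oV V0)).
  have mU := Borel_open R X U oU.
  have mV := Borel_open R X _ oV.
  rewrite (measureDI m mV measurable_kerstar).
  rewrite [X in (_ + X)%E](_ : _ = 0%E) ?adde0.
    apply: le_measure; rewrite ?inE.
    - by apply: measurableD => //; exact: measurable_kerstar.
    - exact: measurableI.
    - by move=> y [[Uy nCy] nk]; split => // -[].
  apply/eqP; rewrite eq_le measure_ge0 andbT -(kerstar_D0_null m mT).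
  apply: le_measure; rewrite ?inE.
  - by apply: measurableI => //; exact: measurable_kerstar.
  - apply: measurableD; first exact: measurable_kerstar.
    exact: Borel_closed (polish_closed1 0).
  - by move=> y [[Uy nCy] ky]; split => //= y0; apply: nCy; rewrite y0.
have E0 : (0 < m E)%E by rewrite -[E]setTI; apply: posE; [exact: openT|exists 0].
have Efin : m E \is a fin_num by exact: fin_num_measure.
have fE0 : 0 < fine (m E) by rewrite -lte_fin fineK.
(* This is [m] conditioned on [E]; the second argument [m] is the fallback for mass zero or
   infinity, ruled out by [E0] and [Efin]. *)
pose p : measures X := mnormalize (mrestr m mE) m.
have pE A : p A = (m (A `&` E) * ((fine (m E))^-1)%:E)%E.
  transitivity ((if (m (setT `&` E) == 0) || (m (setT `&` E) == +oo)
    then fun U => m U else fun U => m (U `&` E) * ((fine (m (setT `&` E)))^-1)%:E) A)%E => //.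
  by rewrite setTI gt_eqF//= -(fineK Efin).
exists p; last first.
  rewrite pE [X in m X](_ : _ = set0) ?measure0 ?mul0e//.
  by rewrite -subset0 => x [Cx]; apply; left.
split; last split.
(* [T^-1 E] lies in [E] and has the same mass, so the two agree up to a null set and [E] may be
   exchanged for its preimage. *)
- move=> A mA; rewrite !pE; congr (_ * _)%E.
  rewrite -[RHS]mT; last exact: measurableI.
  rewrite preimage_setI.
  have mTA := mTi _ mA; have mTE := mTi _ mE.
  rewrite (measureDI m (measurableI _ _ mTA mE) mTE) -setIA (setIidr TE).
  rewrite [X in (X + _)%E](_ : _ = 0%E) ?add0e//.
  have D0 : m (E `\` T @^-1` E) = 0%E.
    transitivity (m E - m (T @^-1` E))%E; last by rewrite mT// subee.
    by rewrite measureD -?ge0_fin_numE// (setIidr TE).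
  apply/eqP; rewrite eq_le measure_ge0 andbT -D0.
  apply: le_measure; rewrite ?inE.
  - by apply: measurableD => //; exact: measurableI.
  - exact: measurableD.
  - by move=> x [[_ Ex] nx].
- move=> U oU U0; rewrite pE mule_gt0//; first exact: posE.
  by rewrite lte_fin invr_gt0.
- exact: probability_setT.
Qed.

End Conditioning.

Lemma continuous_pair (A B C : topologicalType) (f : A -> B) (g : A -> C) (x : A) :
  {for x, continuous f} -> {for x, continuous g} ->
  {for x, continuous (fun y => (f y, g y))}.
Proof. by move=> cf cg; exact: (cvg_pair cf cg). Qed.

(** * The law of [x + r y] for independent [x] and [y] *)

Section Perturbation.
Context (R : realType) (X : topologicalLmodType R).
Hypothesis pX : polish_space X.

Definition addscale (r : R) (z : X * X) : X := z.1 + r *: z.2.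


(** Continuity jointly in [r] and the pair serves both measurability at fixed [r] and the limit
    [r -> 0]. *)
Lemma addscale_continuous : continuous (fun q : R^o * (X * X) => addscale q.1 q.2).
Proof.
move=> q; apply: (@continuous_comp _ _ _
  (fun q : R^o * (X * X) => (q.2.1, q.1 *: q.2.2)) (fun z : X * X => z.1 + z.2));
  last exact: add_continuous.
apply: continuous_pair.
  by apply: (@continuous_comp _ _ _ snd fst); [exact: cvg_snd|exact: cvg_fst].
apply: (@continuous_comp _ _ _
  (fun q : R^o * (X * X) => (q.1, q.2.2)) (fun z : R^o * X => z.1 *: z.2));
  last exact: scale_continuous.
apply: continuous_pair; first exact: cvg_fst.
by apply: (@continuous_comp _ _ _ snd snd); exact: cvg_snd.
Qed.

Lemma addscale_continuous_r r : continuous (addscale r).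
Proof.
move=> z; apply: (@continuous_comp _ _ _ (pair (r : R^o))
  (fun q : R^o * (X * X) => addscale q.1 q.2)); last exact: addscale_continuous.
by apply: continuous_pair; [exact: cvg_cst|exact: cvg_id].
Qed.

Lemma addscale_cvg (r : nat -> R) (z : X * X) :
  r @ \oo --> (0 : R) -> addscale (r n) z @[n --> \oo] --> z.1.
Proof.
move=> r0; have -> : z.1 = addscale 0 z by rewrite /addscale scale0r addr0.
have cz : {for 0, continuous (fun s : R^o => addscale s z)}.
  apply: (@continuous_comp _ _ _ (fun s : R^o => (s, z))
    (fun q : R^o * (X * X) => addscale q.1 q.2)); last exact: addscale_continuous.
  by apply: continuous_pair; [exact: cvg_id|exact: cvg_cst].
exact: (cvg_comp _ _ r0 cz).
Qed.

Lemma measurable_addscale r :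
  measurable_fun setT (addscale r : Borel X * Borel X -> Borel X).
Proof. exact: continuous_Borel2 (addscale_continuous_r r). Qed.

Lemma measurable_preimage_addscale r (A : set X) : measurable (A : set (Borel X)) ->
  measurable (addscale r @^-1` A : set (Borel X * Borel X)).
Proof. by move=> mA; rewrite -[X in measurable X]setTI; exact: measurable_addscale. Qed.

(** By linearity [T (x + r y) = T x + r T y]. Slicing at [x], invariance of [n] removes [T] from
    [y]; a change of variables and invariance of [m] then remove it from [x]. *)
Lemma addscale_invariant (T : {linear X -> X}) (m n : measures X) r (A : set X) :
  continuous T -> T_invariant T m -> T_invariant T n ->
  measurable (A : set (Borel X)) ->
  (m \x n)%E (addscale r @^-1` (T @^-1` A)) = (m \x n)%E (addscale r @^-1` A).
Proof.
move=> cT mT nT mA; rewrite /product_measure1.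
have mS := measurable_preimage_addscale r A mA.
have mTf := continuous_Borel R X T cT.
transitivity (\int[m]_x ((n \o xsection (addscale r @^-1` A)) \o T) x)%E.
  apply: eq_integral => x _ /=.
  rewrite -[RHS]nT; last exact: (@measurable_xsection _ _ (Borel X) (Borel X) _ (T x) mS).
  congr (n _); apply/seteqP; split=> y; rewrite /xsection/= !inE /addscale/=.
    by rewrite linearD linearZ.
  by rewrite linearD linearZ.
transitivity (\int[pushforward m (T : Borel X -> Borel X)]_x
    (n \o xsection (addscale r @^-1` A)) x)%E.
  by rewrite ge0_integral_pushforward//; exact: measurable_fun_xsection.
have [p pE] := exists_pushforward_probability _ _ _ _ _ m _ mTf.
rewrite -pE; apply: eq_measure_integral => B mB _.
exact: etrans (congr1 (@^~ B) pE) (mT B mB).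
Qed.

(** Every slice at [x] is open and contains [(u - x)/r] for [u] in [U], so it has positive [n]-mass.
    Here [m] is arbitrary, as the density argument requires. *)
Lemma addscale_full_support (m n : measures X) r (U : set X) :
  r != 0 -> full_support n -> open U -> U !=set0 ->
  (0 < (m \x n) (addscale r @^-1` U))%E.
Proof.
move=> r0 fn oU [u Uu]; rewrite lt0e measure_ge0 andbT; apply/eqP => I0.
have mS := measurable_preimage_addscale r U (Borel_open R X U oU).
have mx := measurable_fun_xsection n mS.
have pos x : (0 < (n \o xsection (addscale r @^-1` U)) x)%E.
  apply: fn.
    have -> : xsection (addscale r @^-1` U) x = (fun y => addscale r (x, y)) @^-1` U.
      by apply/seteqP; split=> y; rewrite /xsection/= inE.
    move: oU; apply: open_comp => y _.
    apply: (@continuous_comp _ _ _ (pair x) (addscale r)); last exact: addscale_continuous_r.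
    by apply: continuous_pair; [exact: cvg_cst|exact: cvg_id].
  exists (r^-1 *: (u - x)); rewrite /xsection/= inE /addscale/=.
  by rewrite scalerA mulfV// scale1r addrC subrK.
have : (\int[m]_x `|(n \o xsection (addscale r @^-1` U)) x| = 0)%E.
  by rewrite -[RHS]I0; apply: eq_integral => x _; rewrite gee0_abs.
(* A zero integral would make the slice mass vanish outside a null set [N]; as it vanishes nowhere,
   [N] is the whole space, of mass 1. *)
move=> /(ae_eq_integral_abs m measurableT mx)[N [mN N0 Nsub]].
have NT : N = setT.
  apply/seteqP; split => // x _; apply: Nsub => /= /(_ I) h.
  by have := pos x; rewrite /= h ltxx.
have m1 := probability_setT m; by move: N0; rewrite NT [X in X = _]m1 => /eqP; rewrite onee_eq0.
Qed.

(** The first marginal of the product is [m]; this identifies the limit at [r = 0]. *)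
Lemma integral_fst (m n : measures X) (f : X -> R) : bounded_continuous f ->
  (\int[m \x n]_z (f z.1)%:E = \int[m]_x (f x)%:E)%E.
Proof.
move=> [cf [M fM]].
have mfst : measurable_fun setT (fst : Borel X * Borel X -> Borel X) by [].
have mf : measurable_fun setT (f : Borel X -> R) by exact: continuous_Borel_real.
transitivity (\int[pushforward (m \x n) (fst : Borel X * Borel X -> Borel X)]_x
    (f x)%:E)%E.
  rewrite integral_pushforward//; first exact/measurable_EFinP.
  apply: (bounded_measurable_integrable _ _ _ (m \x n)%E (f \o fst) M) => //.
    exact: measurableT_comp mf mfst.
  by move=> y; exact: fM.
have [p pE] := exists_pushforward_probability _ _ _ _ _ (m \x n)%E _ mfst.
transitivity (\int[p]_x (f x)%:E)%E; first by rewrite pE.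
apply: eq_measure_integral => B mB _.
apply: (etrans (congr1 (@^~ B) pE)).
transitivity ((m \x n)%E (B `*` setT)).
  by congr (product_measure1 m n _); apply/seteqP; split=> -[x y] //= [].
have n1 := probability_setT n.
by rewrite product_measure1E// [X in (_ * X)%E]n1 mule1.
Qed.

Lemma cvg_integral_addscale (m n : measures X) (r : nat -> R) (f : X -> R) :
  bounded_continuous f -> r @ \oo --> (0 : R) ->
  (\int[m \x n]_z (f (addscale (r k) z))%:E @[k --> \oo] --> \int[m]_x (f x)%:E)%E.
Proof.
move=> bf r0; rewrite -(integral_fst m n f bf).
case: bf => cf [M fM].
apply: (@bounded_cvg_integral _ _ _ (m \x n)%E
  (fun k z => f (addscale (r k) z)) (fun z => f z.1) M) => //.
- move=> k; apply: (measurableT_comp (continuous_Borel_real R X f cf)).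
  exact: measurable_addscale.
- by move=> z; apply: (cvg_comp _ _ (addscale_cvg r z r0)); exact: cf.
Qed.

End Perturbation.

(* Two points [x + r y] and [x + s y] of [F] with [r <> s] put a multiple of [y]
   in [F - F]; so off the null set [y \in C] the events [x + r y \in F] are
   pairwise disjoint, and all but countably many of them are null. *)
Lemma exists_small_addscale_null (R : realType) (X : topologicalLmodType R)
    (m n : measures X) (F C : set X) (e : R) :
  polish_space X -> closed F -> closed C -> diffset F `<=` C ->
  dilation_invariant (diffset F) -> n C = 0%E -> 0 < e ->
  exists r, [/\ 0 < r, r < e & (m \x n)%E (addscale R X r @^-1` F) = 0%E].
Proof.
move=> pX cF cC FC dF nC0 e0.
have mF := Borel_closed R X F cF; have mC := Borel_closed R X C cC.
have mS r := measurable_preimage_addscale R X pX r F mF.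
pose D : set (Borel X * Borel X) := setT `*` C.
have mD : measurable D by exact: measurableX.
have D0 : (m \x n)%E D = 0%E by rewrite product_measure1E// [X in (_ * X)%E]nC0 mule0.
have scale_diff r s x y : r < s -> F (addscale R X r (x, y)) ->
    F (addscale R X s (x, y)) -> C y.
  move=> rs Fr Fs; apply: FC; rewrite -(dF (s - r)^-1) ?invr_gt0 ?subr_gt0//.
  exists ((s - r) *: y); last by rewrite scalerA mulVf ?scale1r// subr_eq0 gt_eqF.
  exists (addscale R X s (x, y)) => //; exists (addscale R X r (x, y)) => //.
  by rewrite /addscale/= opprD addrACA subrr add0r -scalerBl.
pose A r := addscale R X r @^-1` F `\` D.
have mA r : measurable (A r : set (Borel X * Borel X)) by exact: measurableD.
have tA r s : 0 < r -> 0 < s -> r != s -> A r `&` A s = set0.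
  move=> _ _ rs; rewrite -subset0 => -[x y] [[Fr nC] [Fs _]]; apply: nC; split => //=.
  by case/orP: (lt_total rs) => h; [exact: (scale_diff r s x)|exact: (scale_diff s r x)].
have [r [r0 re rN]] := exists_small_measure0 _ _ _ (m \x n)%E A e mA tA e0.
exists r; split => //; apply/eqP; rewrite eq_le measure_ge0 andbT.
(* Outside [D] the event is null by the choice of [r]; inside it is bounded by the null set [D]. *)
rewrite [leLHS](measureDI _ (mS r) mD) [X in (X + _)%E]rN add0e -D0.
by apply: le_measure; rewrite ?inE//; exact: measurableI.
Qed.

(** * Density, and assembly of the result *)

Lemma PTstar_dense (R : realType) (X : topologicalLmodType R)
    (T : {linear X -> X}) (n : measures X) (F C : set X) :
  polish_space X -> continuous T -> closed F -> closed C ->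
  diffset F `<=` C -> dilation_invariant (diffset F) ->
  PTstar T setT n -> n C = 0%E -> dense_in (PT T) (PTstar T (~` F)).
Proof.
move=> pX cT cF cC FC dF [nT [fn _]] nC0; split; first by move=> m [].
move=> U oU [m [Um mT]].
have mF := Borel_closed R X F cF.
have [fs [eps [eps0 bfs fsU]]] := oU m Um.
have ex k : exists r, [/\ 0 < r, r < k.+1%:R^-1 &
    (m \x n)%E (addscale R X r @^-1` F) = 0%E].
  by apply: exists_small_addscale_null cC FC dF nC0 _ => //; rewrite invr_gt0.
have [r rP] := choice ex.
have r_cvg0 : r @ \oo --> (0 : R).
  apply: (@squeeze_cvgr _ _ _ _ (cst 0) (fun k => k.+1%:R^-1)).
  - by apply: nearW => k; have [r0 rk _] := rP k; rewrite /= !ltW.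
  - exact: cvg_cst.
  - exact: cvg_harmonic.
have [k near_k] : exists k, forall f, f \in fs ->
    (`| \int[m \x n]_z (f (addscale R X (r k) z))%:E - \int[m]_x (f x)%:E | < eps%:E)%E.
  suff [N _ HN] : \forall k \near \oo, forall f, f \in fs ->
      (`| \int[m \x n]_z (f (addscale R X (r k) z))%:E - \int[m]_x (f x)%:E | < eps%:E)%E.
    by exists N; apply: HN => /=.
  (* A weak neighbourhood involves finitely many test functions, so induction on the list intersects
     finitely many tails of indices. *)
  elim: fs bfs {fsU} => [|f fs IH] bfs; first exact: nearW.
  have bf : bounded_continuous f by apply: bfs; rewrite inE eqxx.
  have fin : (\int[m]_x (f x)%:E)%E \is a fin_num.
    case: bf => cf [M fM]; apply: integrable_fin_num => //.
    apply: (bounded_measurable_integrable _ _ _ m f M) => //.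
    exact: continuous_Borel_real.
  have cvf : \forall k \near \oo, (`| \int[m \x n]_z (f (addscale R X (r k) z))%:E -
      \int[m]_x (f x)%:E | < eps%:E)%E.
    have /sube_cvg0 := cvg_integral_addscale R X pX m n r f bf r_cvg0.
    move=> /(_ fin)/(cvg_abse0P _).2 h.
    have eps0' : (0 < eps%:E)%E by rewrite lte_fin.
    exact: h (open_ereal_lt' eps0').
  have {}IH : \forall k \near \oo, forall g, g \in fs -> (`| \int[m \x n]_z
      (g (addscale R X (r k) z))%:E - \int[m]_x (g x)%:E | < eps%:E)%E.
    by apply: IH => g gfs; apply: bfs; rewrite inE gfs orbT.
  near=> k => g; rewrite inE => /predU1P[->|gfs].
    by near: k.
  by move: g gfs; near: k.
have [r0 _ rF] := rP k.
(* The law of [x + r_k y] is the required measure in [U]. *)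
have [p pE] := exists_pushforward_probability _ _ _ _ _ (m \x n)%E _
  (measurable_addscale R X pX (r k)).
have pA A : p A = (m \x n)%E (addscale R X (r k) @^-1` A) by rewrite pE.
exists p; split.
  apply: fsU => f ffs /=; have [cf [M fM]] := bfs f ffs.
  have mf := continuous_Borel_real R X f cf.
  have -> : (\int[p]_x (f x)%:E = \int[m \x n]_z (f (addscale R X (r k) z))%:E)%E.
    rewrite pE integral_pushforward//; first exact: measurable_addscale.
      exact/measurable_EFinP.
    apply: (bounded_measurable_integrable _ _ _ (m \x n)%E
      (fun z => f (addscale R X (r k) z)) M) => //.
    exact: measurableT_comp mf (measurable_addscale R X pX (r k)).
  exact: near_k.
split; first by move=> A mA; rewrite !pA; exact: addscale_invariant.
split; first by move=> V oV V0; rewrite pA; apply: addscale_full_support => //; rewrite gt_eqF.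
by rewrite probability_setC// pA [X in (_ - X)%E]rF sube0.
Unshelve. all: end_near. Qed.

Theorem lemma3 (R : realType) (X : topologicalLmodType R)
  (T : {linear X -> X}) (F : set X) :
  polish_space X ->
  continuous T ->
  PTstar T setT !=set0 ->
  closed F ->
  dilation_invariant (diffset F) ->
  nowhere_dense (diffset F) ->
  T @` (F `\` kerstar T) `<=` F ->
  T @` (closure (diffset F) `\` kerstar T) `<=` closure (diffset F) ->
  dense_in (PT T) (PTstar T (~` F)) /\ Gdelta_in (PT T) (PTstar T (~` F)).
Proof.
move=> pX cT [m mP] cF dF nF _ TC.
split; last exact: full_support_Gdelta.
have cC : closed (closure (diffset F)) by exact: closed_closure.
have [n nP nC0] : exists2 n, PTstar T setT n & n (closure (diffset F)) = 0%E.
  (* Conditioning needs [0] in the closure of [F - F], which fails for empty [F]; there the closure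
     is empty and [m] itself serves. *)
  have [F0|/set0P[x Fx]] := eqVneq F set0.
    exists m => //; rewrite (_ : closure _ = set0) ?measure0//.
    rewrite -closure0; congr closure; rewrite -subset0 F0.
    by move=> y [a []].
  apply: (exists_conditioned_measure R X pX T cT _ m) => //.
  by apply: subset_closure; exists x => //; exists x => //; rewrite subrr.
exact: (PTstar_dense R X T n F _ pX cT cF cC (@subset_closure _ _) dF nP nC0).
Qed.
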